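(* The Krull dimension of the ring $\mathscr{H}^\infty$ of bounded Dirichlet series is infinite.
   Context: Let $\mathbb{N}=\{1,2,3,\dots\}$ and $\mathbb{C}_{>0}=\{s\in\mathbb{C}:\operatorname{Re}(s)>0\}$. $\mathscr{H}^\infty$ denotes the set of Dirichlet series $f(s)=\sum_{n=1}^\infty \frac{a_n}{n^s}$, where $(a_n)_{n\in\mathbb{N}}$ is a sequence of complex numbers, such that $f$ is holomorphic and bounded in $\mathbb{C}_{>0}$ (i.e. the bounded holomorphic functions $f$ on $\mathbb{C}_{>0}$ that are represented by a Dirichlet series converging in some half-plane $\operatorname{Re}(s)>\sigma_0$; by a theorem of Bohr the series then converges in all of $\mathbb{C}_{>0}$). With pointwise operations and the norm $\|f\|_\infty=\sup_{s\in\mathbb{C}_{>0}}|f(s)|$, $\mathscr{H}^\infty$ is a unital commutative complex Banach algebra. The Krull dimension of a commutative ring $R$ is the supremum of the lengths of chains of distinct proper prime ideals of $R$. *)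

(* Defs.v *)
From HB Require Import structures.
From mathcomp Require Import all_boot all_order all_algebra ring_quotient.
From mathcomp Require Import all_classical all_reals all_analysis.
From mathcomp Require Import complex ring lra.

Set Implicit Arguments.
Unset Strict Implicit.
Unset Printing Implicit Defensive.

Import Order.TTheory GRing.Theory Num.Theory.
Import numFieldNormedType.Exports.

Local Open Scope classical_set_scope.
Local Open Scope complex_scope.
Local Open Scope ring_scope.

(* The library puts no topology on R[i] itself; as a normed space over itself
   it is the regular module R[i]^o. *)
Notation Cplx R := ((R[i])^o).

Section krull_dimension.

(* A term of prime_idealr A is a prime ideal of A not containing 1, given by a
   boolean predicate; classically every prime ideal arises this way.
   The length of the chain P 0, P 1, ..., P n is n. *)
Definition prime_chain (A : comNzRingType) (n : nat)
    (P : 'I_n.+1 -> prime_idealr A) : Prop :=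
  forall i j : 'I_n.+1, (i < j)%N -> [set` P i] `<` [set` P j].

Definition krull_dim (R : realType) (A : comNzRingType) : \bar R :=
  ereal_sup [set n%:R%:E | n in
    [set n | exists P : 'I_n.+1 -> prime_idealr A, prime_chain P]].

End krull_dimension.

Section dirichlet_series.
Variable R : realType.
Implicit Types (z : Cplx R) (a b : nat -> Cplx R).

Definition cexp z : Cplx R :=
  (expR (complex.Re z))%:C * (cos (complex.Im z) +i* sin (complex.Im z)).

(* n^(-s) = exp (- s ln n), for n > 0 *)
Definition npowN (n : nat) (s : Cplx R) : Cplx R := cexp (- (s * (ln (n%:R : R))%:C)).

(* The N-th partial sum is the sum of a_n n^(-s) over 1 <= n <= N; the value
   a 0 is never used. *)
Definition dirichlet_psum a (s : Cplx R) : nat -> Cplx R :=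
  series (fun k => a k.+1 * npowN k.+1 s).

Definition halfplane : Type := {s : Cplx R | 0 < complex.Re s}.

Definition ext0 (f : halfplane -> Cplx R) (s : Cplx R) : Cplx R :=
  if insub s is Some t then f t else 0.

(* Complex differentiability of ext0 f at a point of the open half-plane only
   depends on f. *)
Definition holomorphic (f : halfplane -> Cplx R) : Prop :=
  forall s : halfplane, derivable (ext0 f) (val s) (1 : Cplx R).

Definition bounded_hp (f : halfplane -> Cplx R) : Prop :=
  exists M : Cplx R, forall s, `|f s| <= M.

Definition has_dirichlet_series (f : halfplane -> Cplx R) : Prop :=
  exists (a : nat -> Cplx R) (sigma0 : R), forall s : halfplane,
    sigma0 < complex.Re (val s) -> dirichlet_psum a (val s) @ \oo --> f s.

Definition bdd_dirichlet : {pred halfplane -> Cplx R} := fun f =>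
  `[< [/\ holomorphic f, bounded_hp f & has_dirichlet_series f] >].

HB.instance Definition _ := Choice.on halfplane.

Lemma hp1_subproof : 0 < complex.Re (1 : Cplx R).
Proof. exact: ltr01. Qed.

HB.instance Definition _ :=
  isPointed.Build halfplane (Sub (1 : Cplx R) hp1_subproof).

Lemma halfplane_open (s : halfplane) :
  \forall z \near (val s : Cplx R), 0 < complex.Re z.
Proof.
have s0 := valP s.
apply/(nbhs_normP (val s : Cplx R)); exists ((complex.Re (val s))%:C) => /=.
  by rewrite ltcR.
move=> z /= /(le_lt_trans (normc_ge_Re _)); rewrite ltcR raddfB /= => h.
by have := le_lt_trans (ler_norm _) h; lra.
Qed.

Lemma ext0E (f : halfplane -> Cplx R) s : ext0 f (val s) = f s.
Proof. by rewrite /ext0 valK. Qed.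

Lemma holomorphic1 : holomorphic 1.
Proof.
move=> s; apply: near_eq_derivable; last exact: (derivable_cst (1 : Cplx R)).
near=> z; have z0 : 0 < complex.Re z by near: z; exact: halfplane_open.
by rewrite /ext0 insubT.
Unshelve. all: by end_near. Qed.

Lemma ext0B f g : ext0 (f - g) = ext0 f - ext0 g.
Proof.
apply/funext => z; rewrite -[RHS]/(ext0 f z - ext0 g z) /ext0.
by case: insubP => //=; rewrite subr0.
Qed.

Lemma ext0M f g : ext0 (f * g) = ext0 f * ext0 g.
Proof.
apply/funext => z; rewrite -[RHS]/(ext0 f z * ext0 g z) /ext0.
by case: insubP => //=; rewrite mulr0.
Qed.

Lemma holomorphicB f g : holomorphic f -> holomorphic g -> holomorphic (f - g).
Proof. by move=> hf hg s; rewrite ext0B; apply: derivableB; [exact: hf|exact: hg]. Qed.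

Lemma holomorphicM f g : holomorphic f -> holomorphic g -> holomorphic (f * g).
Proof. by move=> hf hg s; rewrite ext0M; apply: derivableM; [exact: hf|exact: hg]. Qed.

Lemma bounded_hp1 : bounded_hp 1.
Proof. by exists 1 => s; rewrite normr1. Qed.

Lemma bounded_hpB f g : bounded_hp f -> bounded_hp g -> bounded_hp (f - g).
Proof.
move=> [M fM] [N gN]; exists (M + N) => s.
by rewrite (le_trans (ler_normB _ _)) // lerD.
Qed.

Lemma bounded_hpM f g : bounded_hp f -> bounded_hp g -> bounded_hp (f * g).
Proof.
move=> [M fM] [N gN]; exists (M * N) => s.
by rewrite [leLHS]normrM ler_pM.
Qed.

Lemma cexpD z (s : Cplx R) : cexp (z + s) = cexp z * cexp s.
Proof.
case: z s => [x y] [u v]; rewrite /cexp /= expRD cosD sinD.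
apply/eqP; rewrite eq_complex /=; apply/andP; split; apply/eqP; ring.
Qed.

Lemma cexp0 : cexp 0 = 1.
Proof. by rewrite /cexp /= expR0 cos0 sin0 mul1r. Qed.

Lemma norm_cexp z : `|cexp z| = (expR (complex.Re z))%:C.
Proof.
rewrite /cexp normrM normc_def /= expr0n addr0 sqrtr_sqr.
by rewrite normc_def /= cos2Dsin2 sqrtr1 mulr1 ger0_norm ?expR_ge0.
Qed.

Lemma npowN1 s : npowN 1 s = 1.
Proof. by rewrite /npowN ln1 mulr0 oppr0 cexp0. Qed.

Lemma npowNM m n (s : Cplx R) : npowN (m.+1 * n.+1) s = npowN m.+1 s * npowN n.+1 s.
Proof.
by rewrite /npowN -cexpD natrM lnM ?posrE ?ltr0Sn // rmorphD /= mulrDr opprD.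
Qed.

Lemma npowN_shift n s : npowN n.+1 s = npowN n.+1 (s - 2) * npowN n.+1 2.
Proof. by rewrite /npowN -cexpD -opprD -mulrDl subrK. Qed.

Lemma norm_npowN2 n : `|npowN n.+1 2| = ((n.+1%:R ^+ 2)^-1 : R)%:C.
Proof.
rewrite norm_cexp; congr (_ %:C).
rewrite raddfN /= mulr0 subr0 expRN mulrDl mul1r expRD lnK ?posrE ?ltr0Sn //.
Qed.

Lemma sum_inv_sq_le N : \sum_(k < N) (k.+1%:R ^+ 2)^-1 <= 2 :> R.
Proof.
suff: \sum_(k < N) (k.+1%:R ^+ 2)^-1 <= 2 - (N%:R)^-1 :> R.
  move/le_trans; apply; by rewrite gerBl invr_ge0 ler0n.
elim: N => [|N IH]; first by rewrite big_ord0 invr0 subr0.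
rewrite big_ord_recr /=; case: N IH => [|N] IH.
  by rewrite big_ord0 add0r expr1n invr1; lra.
apply: le_trans (lerD IH (lexx _)) _.
set x : R := N.+1%:R; have x0 : 0 < x by rewrite ltr0Sn.
have -> : N.+2%:R = x + 1 :> R by rewrite -natr1.
have x1 : 0 < x + 1 by rewrite addr_gt0.
have -> : x^-1 = (x + 1)^-1 + (x * (x + 1))^-1 by field; rewrite !gt_eqF.
have : ((x + 1) ^+ 2)^-1 <= (x * (x + 1))^-1.
  rewrite lef_pV2 ?posrE ?mulr_gt0 ?exprn_gt0 // expr2 ler_wpM2r ?ltW //.
  by rewrite ltrDl.
move: ((x + 1) ^- 2) ((x * (x + 1))^-1) ((x + 1)^-1) => u v w; lra.
Qed.

Lemma dirichlet_psum_abs a (s : Cplx R) (l : Cplx R) :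
    dirichlet_psum a (s - 2) @ \oo --> l ->
  exists u : nat -> R, (forall n, 0 <= u n) /\
    (forall n, `|a n.+1 * npowN n.+1 s| = (u n)%:C) /\ cvgn (series u).
Proof.
move=> /cvgP /cvg_series_cvg_0 /cvgr0Pnorm_lt /(_ 1 ltr01) [N _ HN].
pose w n : R := complex.Re `|a n.+1 * npowN n.+1 (s - 2)|.
have wE n : `|a n.+1 * npowN n.+1 (s - 2)| = (w n)%:C.
  by rewrite /w RRe_real ?normr_real.
have w0 n : 0 <= w n by rewrite -lecR -wE normr_ge0.
pose M : R := 1 + \sum_(i < N) w i.
have wM n : w n <= M.
  case: (ltnP n N) => [nN|Nn].
    rewrite /M (bigD1 (Ordinal nN)) //= addrCA lerDl addr_ge0 ?sumr_ge0 //.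
  have := HN n Nn; rewrite /= wE (_ : 1 = (1 : R)%:C) // ltcR => /ltW h.
  by rewrite (le_trans h) // /M lerDl sumr_ge0.
exists (fun n => w n * (n.+1%:R ^+ 2)^-1); split; first by move=> n; rewrite mulr_ge0.
split=> [n|].
  by rewrite npowN_shift mulrA normrM wE norm_npowN2 -rmorphM.
apply: nondecreasing_is_cvgn.
  apply/nondecreasing_seqP => n; rewrite /series /= big_nat_recr //= lerDl.
  by rewrite mulr_ge0.
exists (M * 2) => _ [n _ <-]; rewrite /series /= big_mkord.
apply: (@le_trans _ _ (\sum_(k < n) M * (k.+1%:R ^+ 2)^-1)).
  by apply: ler_sum => i _; rewrite ler_wpM2r.
rewrite -mulr_sumr ler_wpM2l ?sum_inv_sq_le //.
exact: le_trans (w0 0%N) (wM 0%N).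
Qed.

Definition dirichlet_conv a b (m : nat) : Cplx R :=
  \sum_(i < m) \sum_(j < m | (i.+1 * j.+1 == m)%N) a i.+1 * b j.+1.

Lemma dirichlet_conv_psum a b (s : Cplx R) N :
  dirichlet_psum (dirichlet_conv a b) s N =
  \sum_(i < N) \sum_(j < N | (i.+1 * j.+1 <= N)%N)
     (a i.+1 * npowN i.+1 s) * (b j.+1 * npowN j.+1 s).
Proof.
rewrite /dirichlet_psum /series /= big_mkord.
pose F (i j : nat) := (a i.+1 * npowN i.+1 s) * (b j.+1 * npowN j.+1 s).
transitivity (\sum_(k < N) \sum_(i < N)
    \sum_(j < N | (i.+1 * j.+1 == k.+1)%N) F i j).
  apply: eq_bigr => k _; rewrite /dirichlet_conv mulr_suml.
  rewrite (big_ord_widen_cond N xpredT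
    (fun i => (\sum_(j < k.+1 | (i.+1 * j.+1 == k.+1)%N) a i.+1 * b j.+1)
       * npowN k.+1 s)) //= big_mkcond /=.
  apply: eq_bigr => i _; case: ifPn => [_|ik]; last first.
    rewrite big1 // => j /eqP e; case/negP: ik.
    by rewrite -e; exact: leq_pmulr.
  rewrite mulr_suml (big_ord_widen_cond N (fun j => (i.+1 * j.+1 == k.+1)%N)
    (fun j => a i.+1 * b j.+1 * npowN k.+1 s)) //.
  apply: eq_big => [j|j /andP[/eqP <- _]].
    apply: andb_idr => /eqP <-; exact: leq_pmull.
  by rewrite npowNM /F; ring.
rewrite exchange_big /=; apply: eq_bigr => i _.
under eq_bigr do rewrite big_mkcond /=.
rewrite exchange_big /= [RHS]big_mkcond /=; apply: eq_bigr => j _.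
case: ifPn => [ijN|ijN].
  have kN : ((i.+1 * j.+1).-1 < N)%N by [].
  rewrite (bigD1 (Ordinal kN)) //= eqxx big1 ?addr0 // => k nk.
  case: ifPn => // /eqP e; case/negP: nk; apply/eqP/val_inj => /=.
  exact: esym (congr1 predn e).
by rewrite big1 // => k _; case: ifPn => // /eqP e; case/negP: ijN; rewrite e.
Qed.

Lemma dirichlet_psumM a b (s f g : Cplx R) :
    dirichlet_psum a (s - 2) @ \oo --> (f : Cplx R) ->
    dirichlet_psum b (s - 2) @ \oo --> (g : Cplx R) ->
  (dirichlet_psum a s \* dirichlet_psum b s
    - dirichlet_psum (dirichlet_conv a b) s) @ \oo --> (0 : Cplx R).
Proof.
move=> /dirichlet_psum_abs[u [u0 [uE cu]]] /dirichlet_psum_abs[v [v0 [vE cv]]].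
pose p := series u \* series v.
have cp : cvgn p by exact: is_cvgM.
apply/cvgr0Pnorm_lt => e e0.
have eE : e = (complex.Re e)%:C by rewrite RRe_real ?gtr0_real.
have e0' : 0 < complex.Re e by move: e0; rewrite {1}eE ltcR.
move: (complex.Re e) eE e0' => r -> r0 {e e0}.
have [K _ HK] : \forall n \near \oo, `|lim (p @ \oo) - p n| < r / 2.
  by move/cvgrPdist_lt : cp; apply; rewrite divr_gt0.
exists (K * K)%N => // N /= KKN.
have KN : (K <= N)%N by apply: leq_trans KKN; case: (K) => // k; exact: leq_pmulr.
apply: (@le_lt_trans _ _ ((p N - p K)%:C)); last first.
  rewrite ltcR; have := HK K (leqnn K); have := HK N KN.
  by rewrite /= !ltr_norml => /andP[h1 h2] /andP[h3 h4]; lra.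
pose al i := a i.+1 * npowN i.+1 s; pose be i := b i.+1 * npowN i.+1 s.
have -> : (dirichlet_psum a s \* dirichlet_psum b s
    - dirichlet_psum (dirichlet_conv a b) s) N =
    \sum_(i < N) \sum_(j < N | ~~ (i.+1 * j.+1 <= N)%N) al i * be j.
  rewrite -[LHS]/(_ * _ - _) dirichlet_conv_psum /dirichlet_psum /series /=.
  rewrite !big_mkord mulr_suml -sumrB; apply: eq_bigr => i _.
  rewrite mulr_sumr (bigID (fun j : 'I_N => (i.+1 * j.+1 <= N)%N)) /=.
  by rewrite addrC addrK.
have -> : p N - p K = \sum_(i < N) \sum_(j < N | ~~ ((i < K) && (j < K))%N)
   u i * v j.
  rewrite /p /series /= !big_mkord.
  have -> : (\sum_(i < K) u i) * (\sum_(j < K) v j) =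
     \sum_(i < N) \sum_(j < N | ((i < K) && (j < K))%N) u i * v j.
    rewrite (big_ord_widen N u KN) (big_ord_widen N v KN) mulr_suml big_mkcond /=.
    apply: eq_bigr => i _; case: ifP => _; first by rewrite mulr_sumr.
    by rewrite big_pred0_eq.
  rewrite mulr_suml -sumrB; apply: eq_bigr => i _.
  rewrite mulr_sumr (bigID (fun j : 'I_N => (i < K) && (j < K))%N) /=.
  by rewrite addrC addrK.
rewrite rmorph_sum; apply: le_trans (ler_norm_sum _ _ _) _.
apply: ler_sum => i _; rewrite rmorph_sum.
apply: le_trans (ler_norm_sum _ _ _) _.
rewrite big_mkcond [leRHS]big_mkcond /=; apply: ler_sum => j _.
rewrite normrM uE vE -rmorphM.
have uv0 : 0 <= (u i * v j)%:C by rewrite (_ : 0 = (0 : R)%:C) // lecR mulr_ge0.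
case: ifPn => [ijN|_]; last by case: ifP.
rewrite ifT //; apply: contra ijN => /andP[iK jK].
exact: leq_trans (leq_mul iK jK) KKN.
Qed.

Lemma cvg_subK (F G : nat -> Cplx R) (l : Cplx R) :
  F @ \oo --> l -> (F - G) @ \oo --> (0 : Cplx R) -> G @ \oo --> l.
Proof.
move=> Fl FG0; rewrite (_ : G = F - (F - G)); last by rewrite opprB addrC subrK.
rewrite -[l]subr0; exact: cvgB Fl FG0.
Qed.

Lemma has_dirichlet_series1 : has_dirichlet_series 1.
Proof.
exists (fun n => (n == 1)%:R), 0 => s _.
rewrite -(cvg_shiftn 1).
rewrite (_ : (fun n => _) = cst 1); first exact: cvg_cst.
apply/funext => n; rewrite /dirichlet_psum /series /= addn1 big_nat_recl //=.
by rewrite npowN1 mulr1 big1 ?addr0 // => i _; rewrite mul0r.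
Qed.

Lemma has_dirichlet_seriesB f g : has_dirichlet_series f ->
  has_dirichlet_series g -> has_dirichlet_series (f - g).
Proof.
move=> [a [x hf]] [b [y hg]]; exists (a - b), (Num.max x y) => s.
rewrite gt_max => /andP[xs ys].
rewrite (_ : dirichlet_psum _ _ =
    dirichlet_psum a (val s) - dirichlet_psum b (val s)); last first.
  apply/funext => n; rewrite -[RHS]/(_ - _) /dirichlet_psum /series /= -sumrB.
  by apply: eq_bigr => i _; rewrite -mulrBl.
by apply: cvgB; [exact: hf|exact: hg].
Qed.

Lemma has_dirichlet_seriesM f g : has_dirichlet_series f ->
  has_dirichlet_series g -> has_dirichlet_series (f * g).
Proof.
move=> [a [x hf]] [b [y hg]].
exists (dirichlet_conv a b), (2 + Num.max 0 (Num.max x y)) => s.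
rewrite -ltrBrDl !gt_max => /and3P[s0 xs ys].
have h2 : complex.Re (val s - 2 : Cplx R) = complex.Re (val s) - 2.
  by rewrite raddfB.
pose t : halfplane := exist _ (val s - 2 : Cplx R) (eq_ind_r (is_true \o <%R 0) s0 h2).
have hM := dirichlet_psumM (hf t _) (hg t _).
have /hM {hM} : x < complex.Re (val t) by rewrite h2.
have y't : y < complex.Re (val t) by rewrite h2.
move=> /(_ y't) h0.
have xs' : x < complex.Re (val s) by lra.
have ys' : y < complex.Re (val s) by lra.
have h1 : (dirichlet_psum a (val s) \* dirichlet_psum b (val s)) @ \oo -->
    (f s * g s : Cplx R).
  by apply: cvgM; [exact: hf|exact: hg].
exact: cvg_subK h1 h0.
Qed.

Lemma bdd_dirichlet_subring : subring_closed bdd_dirichlet.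
Proof.
split=> [|f g /asboolP[hf bf df] /asboolP[hg bg dg]
         |f g /asboolP[hf bf df] /asboolP[hg bg dg]]; apply/asboolP; split.
- exact: holomorphic1.
- exact: bounded_hp1.
- exact: has_dirichlet_series1.
- exact: holomorphicB.
- exact: bounded_hpB.
- exact: has_dirichlet_seriesB.
- exact: holomorphicM.
- exact: bounded_hpM.
- exact: has_dirichlet_seriesM.
Qed.

HB.instance Definition _ :=
  GRing.isSubringClosed.Build (halfplane -> Cplx R) bdd_dirichlet
    bdd_dirichlet_subring.

(* The ring operations are those of the functions halfplane -> Cplx R. *)
Record Hinf : Type := MkHinf {
  Hinf_fun :> halfplane -> Cplx R;
  Hinf_prop : Hinf_fun \in bdd_dirichlet
}.

HB.instance Definition _ := [isSub for Hinf_fun].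
HB.instance Definition _ := [Choice of Hinf by <:].
HB.instance Definition _ := [SubChoice_isSubComNzRing of Hinf by <:].

End dirichlet_series.

(* Main.v *)
From HB Require Import structures.
Require Import Defs.
From mathcomp Require Import all_boot all_order all_algebra.
From mathcomp Require Import all_classical all_reals all_analysis.
From mathcomp Require Import ring_quotient complex ring lra.

Set Implicit Arguments.
Unset Strict Implicit.
Unset Printing Implicit Defensive.

Import Order.TTheory GRing.Theory Num.Theory.
Import numFieldNormedType.Exports.

Local Open Scope classical_set_scope.
Local Open Scope complex_scope.
Local Open Scope ring_scope.

(** The ring contains functions that tend to 0 along the positive real axis, as
    s -> 0, at incomparable speeds: each is eventually smaller than every power
    of the next. Fix points p_i -> 0 on the positive reals, an ultrafilter U on nat
    finer than the cofinite filter, and a sequence x_i > 0 tending to 0. The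
    functions f with |f(p_i)| <= x_i^m for U-almost all i, for every m, form an
    ideal, because multiplying by a bounded function or adding two such
    functions costs only a constant, which one more power of x_i absorbs. The
    ideal is prime ([fast_decay_prime]): outside it |f(p_i)| > x_i^m for
    U-almost all i and some m, and these lower bounds multiply. In effect
    -log|f(p_i)| is a valuation up to bounded error, and the ideals come from
    convex subgroups of its value group.

    For a chain it suffices to have functions f_k of the ring with f_k(p_i)
    real, in ]0, 1[, tending to 0, and f_k(p_i) <= f_(k+1)(p_i)^m eventually, for
    every m: the ideal attached to f_(k+1) contains f_k, that attached to f_k
    does not, because |f_k| <= |f_k|^2 fails for values in ]0, 1[.

    Slowly decaying functions come from sequences d_k decreasing to 0
    ([bounded_dirichlet_series_ge_gauge]). The series
      f(s) = sum_k (d_k - d_(k+1)) (1 - (k+2)^(-s))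
    is an absolutely convergent Dirichlet series on Re s >= 0. It tends to 0 as
    s -> 0 along the positive reals, and at the point p_i where
    (i+2)^(-p_i) = 1/2 each term with k >= i is at least half of
    d_k - d_(k+1), so f(p_i) >= d_i / 2. Starting from x_i, the choice
    d_i = 1 / (1 - ln x_i) yields a function whose powers all eventually dominate x_i.

    Holomorphy of such series is proved by summing the second order Taylor
    bound of the terms n^(-s), which is uniform in n on a disc around a point
    with Re s > 0 ([npowN_taylor_le]). *)

(** * Limits and series of complex numbers *)

Section complex_limits.
Variable R : realType.
Implicit Types (z l : Cplx R) (u : nat -> Cplx R) (v : nat -> R).

Lemma norm_real z : `|z| = (complex.Re `|z|)%:C.
Proof. by rewrite RRe_real ?normr_real. Qed.

Lemma normC_le_Re_Im z (r : R) :
  `|complex.Re z| + `|complex.Im z| <= r -> `|z| <= r%:C.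
Proof.
case: z => x y /= h; rewrite [x +i* y]complexE (le_trans (ler_normD _ _))//.
rewrite normrM [`|'i|]normc_def /= expr0n expr1n add0r sqrtr1 mul1r.
rewrite !normc_def /= !expr0n !addr0 !sqrtr_sqr.
by rewrite -rmorphD lecR.
Qed.

Lemma Re_le_norm z (r : R) : `|z| <= r%:C -> `|complex.Re z| <= r.
Proof. by move=> /(le_trans (normc_ge_Re z)); rewrite lecR. Qed.

Lemma Im_le_norm z (r : R) : `|z| <= r%:C -> `|complex.Im z| <= r.
Proof.
have -> : complex.Im z = complex.Re (- (z * 'i)) by rewrite raddfN /= ReiNIm opprK.
move=> zr; apply: Re_le_norm; rewrite normrN normrM.
by rewrite [`|'i|]normc_def /= expr0n expr1n add0r sqrtr1 mulr1.
Qed.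

Lemma cvgC_real (x y : nat -> R) (a b : R) :
  x @ \oo --> a -> y @ \oo --> b ->
  (fun n => (x n +i* y n : Cplx R)) @ \oo --> (a +i* b : Cplx R).
Proof.
move=> /cvgrPdist_le xa /cvgrPdist_le yb.
apply/cvgrPdist_le => e e0.
have eE : e = (complex.Re e)%:C by rewrite RRe_real ?gtr0_real.
have e0' : 0 < complex.Re e by move: e0; rewrite {1}eE ltcR.
rewrite eE; have h0 : 0 < complex.Re e / 2 by rewrite divr_gt0.
near=> n; apply: normC_le_Re_Im => /=.
rewrite [leRHS](splitr (complex.Re e)) lerD //; near: n.
- exact: xa.
- exact: yb.
Unshelve. all: by end_near. Qed.

Lemma cvgC_norm_le u l (r : R) :
  u @ \oo --> l -> (forall n, `|u n| <= r%:C) -> `|l| <= r%:C.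
Proof.
move=> /cvgrPdist_lt ul ur; rewrite norm_real lecR leNgt; apply/negP => rl.
have /ul[N _ /(_ N (leqnn N))/=] : 0 < (complex.Re `|l| - r)%:C by rewrite ltcR subr_gt0.
apply/negP; rewrite -real_leNgt ?normr_real//; last first.
  by rewrite ger0_real// ler0c subr_ge0 ltW.
rewrite rmorphB /= -norm_real lerBlDr (le_trans _ (lerD (lexx _) (ur N)))//.
by rewrite -{1}(subrK (u N) l) ler_normD.
Qed.

(** Reduces to the completeness of the real line through real and imaginary
    parts. *)
Lemma cvgC_series_dominated u v :
  (forall n, `|u n| <= (v n)%:C) -> cvgn (series v) -> cvgn (series u).
Proof.
move=> uv cv.
have dom (w : nat -> R) : (forall n, `|w n| <= v n) -> cvgn (series w).
  move=> wv; apply: normed_cvg; apply: (series_le_cvg _ _ wv cv) => n //=.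
  by rewrite (le_trans _ (wv n)).
have cre : cvgn (series (fun n => complex.Re (u n))).
  by apply: dom => n; exact: Re_le_norm.
have cim : cvgn (series (fun n => complex.Im (u n))).
  by apply: dom => n; exact: Im_le_norm.
apply/cvg_ex; eexists.
rewrite (_ : series u = fun n => (series (fun n => complex.Re (u n)) n
    +i* series (fun n => complex.Im (u n)) n)); first exact: cvgC_real cre cim.
apply/funext => n; rewrite /series /=.
elim/big_ind3 : _ => [//|_ x x' _ y y' -> -> //|i _]; by case: (u i).
Qed.

Lemma cvgC_series_norm_le u v l (r : R) :
  (forall n, `|u n| <= (v n)%:C) -> (forall n, series v n <= r) ->
  series u @ \oo --> l -> `|l| <= r%:C.
Proof.
move=> uv vr ul; apply: (cvgC_norm_le ul) => n.
rewrite (le_trans (ler_norm_sum _ _ _))//.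
rewrite (@le_trans _ _ (series v n)%:C) ?lecR//.
by rewrite /series /= rmorph_sum ler_sum.
Qed.

End complex_limits.

(** * Second order bounds for the complex exponential *)

Section exponential.
Variable R : realType.

Lemma lipschitz1_of_derivative (f df : R -> R) :
  (forall x : R, is_derive x (1 : R) f (df x)) -> (forall x, `|df x| <= 1) ->
  forall x, `|f x - f 0| <= `|x|.
Proof.
move=> fdf df1 x.
have cf : continuous f.
  by move=> y; apply: differentiable_continuous; apply/derivable1_diffP; case: (fdf y).
have [x0|x0] := leP 0 x.
  have [y _ ->] := MVT_segment x0 (fun y _ => fdf y) (continuous_subspaceT cf).
  by rewrite normrM subr0 ler_piMl.
have [y _ E] := MVT_segment (ltW x0) (fun y _ => fdf y) (continuous_subspaceT cf).
by rewrite distrC E normrM sub0r normrN ler_piMl.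
Qed.

Lemma norm_sin_le (y : R) : `|sin y| <= `|y|.
Proof.
rewrite -[sin y]subr0 -{1}(@sin0 R).
by apply: (@lipschitz1_of_derivative _ cos) => x; exact: cos_max.
Qed.

Lemma norm_cosB1_le (y : R) : `|cos y - 1| <= y ^+ 2.
Proof.
have -> : cos y - 1 = - (sin (y / 2) ^+ 2 *+ 2).
  rewrite {1}(_ : y = (y / 2) *+ 2) ?cos_mulr2n ?cos2sin2; first by ring.
  by rewrite -mulr_natr; field.
rewrite normrN ger0_norm ?mulrn_wge0 ?sqr_ge0//.
have : sin (y / 2) ^+ 2 <= (y / 2) ^+ 2.
  rewrite -[leLHS]real_normK ?num_real// -[leRHS]real_normK ?num_real//.
  by rewrite lerXn2r ?nnegrE//; exact: norm_sin_le.
rewrite (_ : y ^+ 2 = 4 * (y / 2) ^+ 2); last by field.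
by move: (sqr_ge0 (y / 2)); rewrite -mulr_natr; lra.
Qed.

Lemma norm_sinB_le (y : R) : `|sin y - y| <= y ^+ 2.
Proof.
(* Both sides are even in y. *)
wlog y0 : y / 0 <= y.
  move=> h; have [/h//|/ltW y0] := leP 0 y.
  by have := h (- y); rewrite sinN -opprD normrN sqrrN oppr_ge0; exact.
have cg : continuous (fun x : R => sin x - x).
  by move=> x; apply: cvgB; [exact: continuous_sin|exact: cvg_id].
have dg (x : R) : is_derive x (1 : R) (fun x => sin x - x) (cos x - 1).
  exact: is_deriveB.
have [x xy E] := MVT_segment y0 (fun x _ => dg x) (continuous_subspaceT cg).
move: E; rewrite sin0 !subr0 => ->.
have {}xy : 0 <= x <= y by rewrite itv_boundlr in xy.
rewrite normrM (ger0_norm y0) expr2 ler_wpM2r//.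
have := @lipschitz1_of_derivative cos (fun x => - sin x) _ _ x.
rewrite cos0 => h; rewrite (le_trans (h _ _))//.
  by move=> z; rewrite normrN sin_max.
by case/andP: xy => x0 xy; rewrite ger0_norm.
Qed.

Lemma expRB1_le (x : R) : `|expR x - 1| <= `|x| * expR `|x|.
Proof.
have [x0|/ltW x0] := leP 0 x.
  rewrite !ger0_norm//; last by rewrite subr_ge0 -expR0 ler_expR.
  have := expR_ge1Dx (- x); rewrite expRN; have := expR_gt0 x.
  move: (expR x) => e e0 h.
  have : (1 - x) * e <= 1 by rewrite -ler_pdivlMr// div1r.
  lra.
rewrite !ler0_norm//; last by rewrite subr_le0 -expR0 ler_expR.
have h := expR_ge1Dx x; have h1 : 1 <= expR (- x) by rewrite -expR0 ler_expR oppr_ge0.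
have : - x * 1 <= - x * expR (- x) by rewrite ler_wpM2l ?oppr_ge0.
lra.
Qed.

Lemma expRB1D_le (x : R) : `|expR x - 1 - x| <= x ^+ 2 * expR `|x|.
Proof.
have e0 : 0 <= expR x - 1 - x by have := expR_ge1Dx x; lra.
rewrite ger0_norm// (@le_trans _ _ (x * (expR x - 1)))//.
  have := expR_ge1Dx (- x); rewrite expRN; have := expR_gt0 x.
  move: (expR x) => e ee h.
  have : (1 - x) * e <= 1 by rewrite -ler_pdivlMr// div1r.
  lra.
rewrite (le_trans (ler_norm _))// normrM -(real_normK (num_real x)) expr2 -mulrA.
by rewrite ler_wpM2l ?expRB1_le.
Qed.

(** The bound grows with |w| only like an exponential, so it can be used for
    w = - h ln n with all n at once. For w = x + i y the real part of
    exp w - 1 - w is (e^x - 1 - x) + e^x (cos y - 1) and the imaginary part is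
    e^x (sin y - y) + (e^x - 1) y: four terms, each at most r^2 e^r. *)
Lemma norm_cexpB1D_le (w : Cplx R) (r : R) : `|w| <= r%:C ->
  `|cexp w - 1 - w| <= (4 * r ^+ 2 * expR r)%:C.
Proof.
move=> wr; have := Re_le_norm wr; have := Im_le_norm wr.
case: w {wr} => x y; rewrite /cexp /= => yr xr; apply: normC_le_Re_Im => /=.
have r0 : 0 <= r := le_trans (normr_ge0 _) xr.
have sq (z : R) : `|z| <= r -> z ^+ 2 <= r ^+ 2.
  by move=> zr; rewrite -(real_normK (num_real z)) lerXn2r ?nnegrE.
have er : expR `|x| <= expR r by rewrite ler_expR.
have ex : expR x <= expR r by rewrite ler_expR (le_trans (ler_norm _)).
have hx : `|expR x - 1 - x| <= r ^+ 2 * expR r.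
  by rewrite (le_trans (expRB1D_le x))// ler_pM ?sqr_ge0 ?expR_ge0 ?sq.
have hc : `|expR x * (cos y - 1)| <= r ^+ 2 * expR r.
  rewrite normrM ger0_norm ?expR_ge0// mulrC ler_pM ?expR_ge0//.
  by rewrite (le_trans (norm_cosB1_le y)) ?sq.
have hs : `|expR x * (sin y - y)| <= r ^+ 2 * expR r.
  rewrite normrM ger0_norm ?expR_ge0// mulrC ler_pM ?expR_ge0//.
  by rewrite (le_trans (norm_sinB_le y)) ?sq.
have hy : `|(expR x - 1) * y| <= r ^+ 2 * expR r.
  rewrite normrM expr2 -mulrA mulrC ler_pM//.
  by rewrite (le_trans (expRB1_le x))// ler_pM ?expR_ge0.
rewrite (_ : _ - x = (expR x - 1 - x) + expR x * (cos y - 1)); last by ring.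
rewrite (_ : _ - y = expR x * (sin y - y) + (expR x - 1) * y); last by ring.
rewrite (le_trans (lerD (ler_normD _ _) (ler_normD _ _)))//.
rewrite (le_trans (lerD (lerD hx hc) (lerD hs hy)))//.
by rewrite le_eqVlt; apply/orP; left; apply/eqP; ring.
Qed.

End exponential.

(** * Absolutely convergent Dirichlet series are in the ring *)

Section absolutely_convergent_dirichlet_series.
Variable R : realType.
Implicit Types (s h : Cplx R) (a : nat -> Cplx R) (v : nat -> R).

Lemma norm_npowN n s :
  `|npowN n s| = (expR (- (complex.Re s * ln (n%:R : R))))%:C.
Proof. by rewrite norm_cexp; case: s => x y; rewrite /= mulr0 subr0. Qed.

Lemma ln_nat_ge0 n : 0 <= ln (n.+1%:R : R).
Proof. by rewrite ln_ge0// ler1n. Qed.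

Lemma norm_npowN_le1 n s : 0 <= complex.Re s -> `|npowN n.+1 s| <= 1.
Proof.
move=> s0; rewrite norm_npowN (_ : 1 = (1 : R)%:C)// lecR expR_le1.
by rewrite oppr_le0 mulr_ge0 ?ln_nat_ge0.
Qed.

(** Follows from u^2 / 2 <= e^u at u = c x / 2. *)
Lemma ler_expRM_half (x c : R) : 0 <= x -> 0 < c ->
  x ^+ 2 * expR (- (c * x / 2)) <= 8 / c ^+ 2.
Proof.
move=> x0 c0; have c20 : 0 < c ^+ 2 by rewrite exprn_gt0.
rewrite expRN ler_pdivrMr ?expR_gt0// mulrAC ler_pdivlMr//.
have /(@expR_ge1Dxn _ _ 1) : 0 <= c * x / 2 by rewrite divr_ge0// mulr_ge0// ltW.
move: (expR _) => e.
rewrite (_ : (c * x / 2) ^+ 2 / 2 = x ^+ 2 * c ^+ 2 / 8); last by field.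
lra.
Qed.

(** The remainder is n^(-s) times that of the exponential at - h ln n. Half of
    the decay of n^(-s) absorbs the factor e^(r ln n), since r <= Re s / 2, and
    the other half absorbs (ln n)^2; this makes the bound independent of n. *)
Lemma npowN_taylor_le n s h (r : R) :
  0 < complex.Re s -> `|h| <= r%:C -> r <= complex.Re s / 2 ->
  `|npowN n.+1 (s + h) - npowN n.+1 s - h * (- (ln (n.+1%:R : R))%:C * npowN n.+1 s)|
  <= (32 / (complex.Re s) ^+ 2 * r ^+ 2)%:C.
Proof.
move=> s0 hr rs; set x := ln _; have x0 : 0 <= x := ln_nat_ge0 n.
have r0 : 0 <= r by rewrite -ler0c (le_trans _ hr).
have -> : npowN n.+1 (s + h) - npowN n.+1 s - h * (- x%:C * npowN n.+1 s) =
    npowN n.+1 s * (cexp (- (h * x%:C)) - 1 - - (h * x%:C)).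
  by rewrite {1}/npowN mulrDl opprD cexpD -/(npowN n.+1 s) -/x; ring.
rewrite normrM norm_npowN -/x.
have hx : `|- (h * x%:C)| <= (r * x)%:C.
  by rewrite normrN normrM rmorphM /= [`|x%:C|]ger0_norm ?ler0c// ler_wpM2r ?ler0c.
rewrite (le_trans (ler_wpM2l _ (norm_cexpB1D_le hx))) ?ler0c ?expR_ge0//.
rewrite -rmorphM lecR.
have h8 := ler_expRM_half x0 s0; set c := complex.Re s in s0 rs h8 *.
apply: (@le_trans _ _ (4 * r ^+ 2 * (x ^+ 2 * expR (- (c * x / 2))))); last first.
  rewrite (_ : 32 / _ * _ = 4 * r ^+ 2 * (8 / c ^+ 2)).
    by rewrite ler_wpM2l ?mulr_ge0 ?sqr_ge0.
  by field; rewrite gt_eqF.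
rewrite (_ : expR _ * _ = 4 * r ^+ 2 * (x ^+ 2 * (expR (- (c * x)) * expR (r * x)))).
  rewrite ler_wpM2l ?mulr_ge0 ?sqr_ge0// ler_wpM2l ?sqr_ge0//.
  rewrite -expRD ler_expR.
  have : r * x <= c / 2 * x by rewrite ler_wpM2r.
  lra.
ring.
Qed.

Section bounded_by_a_summable_sequence.
Variables (a : nat -> Cplx R) (v : nat -> R).
Hypothesis av : forall k, `|a k.+1| <= (v k)%:C.
Hypothesis cv : cvgn (series v).

Let v_ge0 k : 0 <= v k.
Proof. by rewrite -ler0c (le_trans _ (av k)). Qed.

Let series_v_le k : series v k <= limn (series v).
Proof.
apply: nondecreasing_cvgn_le => //; apply/nondecreasing_seqP => n.
by rewrite /series /= big_nat_recr //= lerDl.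
Qed.

Let term_le s k : 0 <= complex.Re s -> `|a k.+1 * npowN k.+1 s| <= (v k)%:C.
Proof.
move=> s0; rewrite normrM -[leRHS]mulr1 ler_pM//; exact: norm_npowN_le1.
Qed.

Let f s := limn (dirichlet_psum a s).

Lemma dirichlet_sum_cvg s : 0 <= complex.Re s ->
  dirichlet_psum a s @ \oo --> limn (dirichlet_psum a s).
Proof. by move=> s0; apply: (cvgC_series_dominated _ cv) => k; exact: term_le. Qed.

Lemma dirichlet_sum_norm_le s : 0 <= complex.Re s ->
  `|limn (dirichlet_psum a s)| <= (limn (series v))%:C.
Proof.
move=> s0; apply: (cvgC_series_norm_le _ series_v_le (dirichlet_sum_cvg s0)) => k.
exact: term_le.
Qed.

(* The termwise derivative; it converges because ln n n^(-Re s) <= 1 / Re s. *)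
Let df s := limn (series (fun k => a k.+1 * (- (ln (k.+1%:R : R))%:C * npowN k.+1 s))).

Let ln_npowN_le n s : 0 < complex.Re s ->
  `|- (ln (n.+1%:R : R))%:C * npowN n.+1 s| <= ((complex.Re s)^-1)%:C.
Proof.
move=> s0; set x := ln _; have x0 : 0 <= x := ln_nat_ge0 n.
rewrite normrM normrN [`|x%:C|]ger0_norm ?ler0c// norm_npowN -/x -rmorphM lecR.
rewrite expRN ler_pdivrMr ?expR_gt0// ler_pdivlMl//.
by rewrite (le_trans _ (expR_ge1Dx _))// lerDr.
Qed.

Lemma dirichlet_sum_taylor_le s h (r : R) :
  0 < complex.Re s -> `|h| <= r%:C -> r <= complex.Re s / 2 ->
  `|f (s + h) - f s - h * df s|
    <= (limn (series v) * (32 / (complex.Re s) ^+ 2) * r ^+ 2)%:C.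
Proof.
move=> s0 hr rs.
have sh0 : 0 <= complex.Re (s + h).
  rewrite raddfD /=; have := Re_le_norm hr; rewrite ler_norml => /andP[+ _].
  lra.
set K := 32 / (complex.Re s) ^+ 2 * r ^+ 2; rewrite -mulrA -/K.
have cdf : cvgn (series
    (fun k => a k.+1 * (- (ln (k.+1%:R : R))%:C * npowN k.+1 s))).
  apply: (@cvgC_series_dominated _ _ (fun k => (complex.Re s)^-1 * v k)) => [k|].
    rewrite normrM mulrC rmorphM /= ler_pM//; exact: ln_npowN_le.
  exact: is_cvg_seriesZ.
apply: (@cvgC_series_norm_le _ (fun k => a k.+1 * (npowN k.+1 (s + h)
  - npowN k.+1 s - h * (- (ln (k.+1%:R : R))%:C * npowN k.+1 s))) (fun k => v k * K)).
- by move=> k; rewrite normrM rmorphM /= ler_pM//; exact: npowN_taylor_le.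
- move=> n; rewrite /series /= -mulr_suml ler_wpM2r ?series_v_le//.
  by rewrite mulr_ge0 ?divr_ge0 ?sqr_ge0.
rewrite (_ : series _ = dirichlet_psum a (s + h) - dirichlet_psum a s
    - cst h * series (fun k => a k.+1 * (- (ln (k.+1%:R : R))%:C * npowN k.+1 s))).
  apply: cvgB; last exact: cvgM (cvg_cst _) cdf.
  by apply: cvgB; apply: dirichlet_sum_cvg => //; exact: ltW.
apply/funext => n; rewrite -[RHS]/(_ - _ - _ * _) /dirichlet_psum /series /=.
by rewrite mulr_sumr -!sumrB; apply: eq_bigr => i _; ring.
Qed.

Lemma dirichlet_sum_derivable s : 0 < complex.Re s -> derivable f s (1 : Cplx R).
Proof.
move=> s0; apply/cvg_ex; exists (df s); apply/cvgrPdist_le => e e0.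
have eE : e = (complex.Re e)%:C by rewrite RRe_real ?gtr0_real.
have e0' : 0 < complex.Re e by move: e0; rewrite {1}eE ltcR.
set K := limn (series v) * (32 / (complex.Re s) ^+ 2).
have K0 : 0 <= K.
  rewrite mulr_ge0 ?divr_ge0 ?sqr_ge0// (le_trans _ (series_v_le 0))//.
  by rewrite /series /= big_geq.
have d0 : 0 < (Num.min (complex.Re s / 2) (complex.Re e / (K + 1)))%:C.
  by rewrite ltcR lt_min !divr_gt0// ltr_wpDl.
near=> h.
have h0 : h != 0 by near: h; exact: nbhs_dnbhs_neq.
have : `|h| <= (Num.min (complex.Re s / 2) (complex.Re e / (K + 1)))%:C.
  by near: h; exact: dnbhs0_le.
rewrite (norm_real h) lecR le_min => /andP[hs he].
have -> : df s - h^-1 *: ((f \o shift s) (h *: 1) - f s) =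
    - ((f (s + h) - f s - h * df s) / h).
  rewrite /= -[h *: 1]/(h * 1) mulr1 (addrC h) -[_ *: _]/(h^-1 * _).
  by move: (f (s + h)) (f s) (df s) => x y z; field.
rewrite normrN normrM normfV ler_pdivrMr ?normr_gt0//.
have hr : `|h| <= (complex.Re `|h|)%:C by rewrite -norm_real.
rewrite (le_trans (dirichlet_sum_taylor_le s0 hr hs))// -/K.
have h1 : 0 <= complex.Re `|h| by rewrite -ler0c -norm_real.
rewrite (norm_real h) eE -rmorphM lecR.
rewrite expr2 mulrA ler_wpM2r//.
move: he; rewrite ler_pdivlMr ?ltr_wpDl//; lra.
Unshelve. all: by end_near. Qed.

Lemma dirichlet_sum_bdd_dirichlet :
  (fun s : halfplane R => limn (dirichlet_psum a (val s))) \in @bdd_dirichlet R.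
Proof.
apply/asboolP; split.
- move=> s; apply: (near_eq_derivable _ (dirichlet_sum_derivable (valP s))).
  near=> z; have z0 : 0 < complex.Re z by near: z; exact: halfplane_open.
  by rewrite /ext0 insubT.
- exists (limn (series v))%:C => s; apply: dirichlet_sum_norm_le.
  exact: ltW (valP s).
- exists a, 0 => s s0; exact: dirichlet_sum_cvg (ltW s0).
Unshelve. all: by end_near. Qed.

End bounded_by_a_summable_sequence.
End absolutely_convergent_dirichlet_series.

(** * Functions of slow decay at the origin *)

Section gauges.
Variable R : realType.
Implicit Types (d x : nat -> R).

Definition gauge x : Prop :=
  [/\ nonincreasing_seq x, forall i, 0 < x i < 1 & x @ \oo --> (0 : R)].

(** Writing x_i = e^(1 - L_i) with L_i -> +oo, this is 1 / L_i: every power of it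
    eventually dominates x_i. *)
Definition slower x (i : nat) : R := (1 - ln (x i))^-1.

Lemma slower_gauge x : gauge x -> gauge (slower x).
Proof.
move=> [xni x01 x0].
have ge1 i : 1 < 1 - ln (x i) by rewrite ltrDl oppr_gt0 ln_lt0.
have pos i : 0 < 1 - ln (x i) by rewrite (lt_trans _ (ge1 i)).
have xpos i : 0 < x i by case/andP: (x01 i).
split=> [i j ij|i|].
- by rewrite /slower lef_pV2 ?posrE// lerD2l lerN2 ler_ln ?posrE// xni.
- by rewrite /slower invr_gt0 pos invf_lt1 ?ge1 ?pos.
apply/cvgr0Pnorm_le => e e0.
have := expR_gt0 (- e^-1); move/cvgr0Pnorm_le : x0 => /[apply].
apply: filterS => i; rewrite ger0_norm ?(ltW (xpos i))// => xe.
rewrite ger0_norm ?invr_ge0 ?(ltW (pos i))// /slower.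
rewrite -[leRHS]invrK lef_pV2 ?posrE ?invr_gt0//.
have : ln (x i) <= - e^-1 by rewrite -ler_expR lnK ?posrE.
lra.
Qed.

(** With L = 1 - ln x_i the claim is e (2 L)^m <= e^L, which holds as soon as
    L >= 2^m (m+1)! e, by the term of degree m + 1 of the exponential series.
    The factor 1/2 is there because a function constructed from a sequence d is
    only bounded below by d / 2. *)
Lemma gauge_le_slowerX x (m : nat) : gauge x ->
  \forall i \near \oo, x i <= (slower x i / 2) ^+ m.
Proof.
move=> gx; have [_ s01 s0] := slower_gauge gx; have [_ x01 _] := gx.
set C : R := 2 ^+ m * (m.+1)`!%:R * expR 1.
have C0 : 0 < C by rewrite !mulr_gt0 ?exprn_gt0 ?expR_gt0 ?ltr0n ?fact_gt0.
have : 0 < C^-1 by rewrite invr_gt0.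
move/cvgr0Pnorm_le : s0 => /[apply]; apply: filterS => i.
have /andP[si0 _] := s01 i; have /andP[xi0 _] := x01 i.
rewrite ger0_norm ?(ltW si0)//; rewrite /slower in si0 *.
have L0 : 0 < 1 - ln (x i) by rewrite -invr_gt0.
rewrite lef_pV2 ?posrE// => CL.
rewrite [leLHS](_ : _ = expR (1 - (1 - ln (x i)))); last first.
  by rewrite opprB addrC subrK lnK.
move: (1 - ln (x i)) L0 CL {si0} => L L0 CL.
rewrite expRD expRN -invfM exprVn -[leLHS]invrK lef_pV2 ?posrE; last 2 first.
- by rewrite invr_gt0 divr_gt0 ?expR_gt0.
- by rewrite exprn_gt0// mulr_gt0.
rewrite invfM invrK [leRHS]mulrC ler_pdivlMr ?expR_gt0//.
have := @expR_ge1Dxn _ L m (ltW L0).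
have : (L * 2) ^+ m * expR 1 <= L ^+ m.+1 / (m.+1)`!%:R.
  rewrite ler_pdivlMr ?ltr0n ?fact_gt0// exprMn exprSr.
  rewrite (_ : _ * _ * _ * _ = L ^+ m * C); last by rewrite /C; ring.
  by rewrite ler_wpM2l// exprn_ge0// ltW.
lra.
Qed.

(** The real number t with (i+2)^(-t) = 1/2. *)
Definition node (i : nat) : R := ln 2 / ln i.+2%:R.

Lemma ln_nat2_gt0 i : 0 < ln (i.+2%:R : R).
Proof. by rewrite ln_gt0// ltr1n. Qed.

Lemma node_gt0 i : 0 < node i.
Proof. by rewrite divr_gt0// ln_nat2_gt0. Qed.

Lemma node_nonincreasing : nonincreasing_seq node.
Proof.
move=> i j ij; rewrite /node ler_pM2l ?(ln_nat2_gt0 0%N)//.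
by rewrite lef_pV2 ?posrE ?ln_nat2_gt0// ler_ln ?posrE ?ltr0n// ler_nat !ltnS.
Qed.

Lemma node_cvg0 : node @ \oo --> (0 : R).
Proof.
apply/cvgr0Pnorm_le => e e0.
have := nbhs_infty_ger (expR (ln 2 / e) : R); apply: filterS => i hi.
rewrite ger0_norm ?(ltW (node_gt0 i))// ler_pdivrMr ?ln_nat2_gt0//.
rewrite -ler_pdivrMl// mulrC -[leLHS]expRK ler_ln ?posrE ?expR_gt0//.
by rewrite (le_trans hi)// ler_nat -addn2 leq_addr.
Qed.

Definition node_pt (i : nat) : halfplane R :=
  exist _ ((node i)%:C : Cplx R) (node_gt0 i).

Lemma npowN_real n (t : R) :
  npowN n (t%:C : Cplx R) = (expR (- (t * ln (n%:R : R))))%:C.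
Proof.
by rewrite /npowN -rmorphM -rmorphN /cexp /= cos0 sin0 mulr1.
Qed.

Section dirichlet_series_of_a_gauge.
Variable d : nat -> R.
Hypothesis gd : gauge d.

Let c k := d k - d k.+1.

Let d_gt0 i : 0 < d i. Proof. by have [_ /(_ i)/andP[]] := gd. Qed.

Let c_ge0 k : 0 <= c k.
Proof. by have [dni _ _] := gd; rewrite subr_ge0 dni. Qed.

(* The Dirichlet coefficients: those of sum_k c_k (1 - (k+2)^(-s)), whose
   constant term is sum_k c_k = d_0. *)
Let a (n : nat) : Cplx R :=
  if n is k.+2 then (- c k)%:C else (d 0%N)%:C.

Let v (n : nat) : R := if n is k.+1 then c k else d 0%N.

Let av k : `|a k.+1| <= (v k)%:C.
Proof.
case: k => [|k] /=; first by rewrite ger0_norm ?ler0c// ltW.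
by rewrite rmorphN normrN ger0_norm ?ler0c.
Qed.

Let series_v n : series v n.+1 = 2 * d 0%N - d n.
Proof.
elim: n => [|n IH]; first by rewrite /series /= big_nat1 /v; lra.
by rewrite /series /= in IH *; rewrite big_nat_recr//= IH /c; lra.
Qed.

Let cvg_v : cvgn (series v).
Proof.
apply: nondecreasing_is_cvgn.
  apply/nondecreasing_seqP => n; rewrite /series /= big_nat_recr//= lerDl.
  by case: n => [|n] /=; [exact: ltW|exact: c_ge0].
exists (2 * d 0%N) => _ [[|n] _ <-].
  by rewrite /series /= big_geq// mulr_ge0// (ltW (d_gt0 _)).
by rewrite series_v gerBl ltW.
Qed.

Let w t k := c k * (1 - expR (- (t * ln (k.+2%:R : R)))).

Let w_ge0 t k : 0 <= t -> 0 <= w t k.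
Proof.
move=> t0; rewrite mulr_ge0// subr_ge0 expR_le1 oppr_le0 mulr_ge0//.
exact: ltW (ln_nat2_gt0 k).
Qed.

(* The constant d_0 is split as d_n + sum_(k < n) c_k. *)
Let psum_real t n :
  dirichlet_psum a (t%:C : Cplx R) n.+1 = (d n + series (w t) n)%:C.
Proof.
elim: n => [|n IH].
  by rewrite /dirichlet_psum /series /= big_nat1 big_geq// npowN1 mulr1 addr0.
rewrite /dirichlet_psum /series /= in IH *; rewrite big_nat_recr//= IH.
rewrite npowN_real -rmorphM -rmorphD /= [in RHS]big_nat_recr//=; congr (_%:C).
by rewrite /w /c /series /=; ring.
Qed.

Let sum_c n : series c n = d 0%N - d n.
Proof.
elim: n => [|n IH]; first by rewrite /series /= big_geq// subrr.
by rewrite /series /= in IH *; rewrite big_nat_recr//= IH /c; lra.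
Qed.

Let series_w_le t n : series (w t) n <= d 0%N.
Proof.
apply: (@le_trans _ _ (series c n)); last by rewrite sum_c gerBl ltW.
by apply: ler_sum => k _; rewrite ler_piMr// gerBl expR_ge0.
Qed.

Let cvg_w t : 0 <= t -> cvgn (series (w t)).
Proof.
move=> t0; apply: nondecreasing_is_cvgn.
  apply/nondecreasing_seqP => n; rewrite /series /= big_nat_recr//= lerDl.
  exact: w_ge0.
by exists (d 0%N) => _ [n _ <-].
Qed.

Let g t := limn (series (w t)).

Let dirichlet_sum_real t : 0 <= t -> limn (dirichlet_psum a (t%:C : Cplx R)) = (g t)%:C.
Proof.
move=> t0; apply/cvg_lim => //; rewrite -(cvg_shiftn 1).
rewrite (_ : (fun n => _) = fun n => ((d n + series (w t) n) +i* 0)); last first.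
  by apply/funext => n; rewrite addn1 psum_real.
apply: cvgC_real; last exact: cvg_cst.
have [_ _ d0] := gd.
by rewrite -[X in _ --> X]add0r; apply: cvgD => //; exact: cvg_w.
Qed.

Let g_le_d0 t : 0 <= t -> g t <= d 0%N.
Proof. by move=> t0; apply: limr_le; [exact: cvg_w|exact: nearW]. Qed.

Let g_nondecreasing s t : 0 <= s -> s <= t -> g s <= g t.
Proof.
move=> s0 st; apply: ler_lim; [exact: cvg_w|exact: cvg_w (le_trans s0 st)|].
apply: nearW => n; apply: ler_sum => k _; rewrite ler_wpM2l//.
by rewrite lerD2l lerN2 ler_expR lerN2 ler_wpM2r// ltW// ln_nat2_gt0.
Qed.

(* The terms of index k >= i are at least c_k / 2, and these sum to d_i / 2. *)
Let g_ge t i : ln 2 <= t * ln (i.+2%:R : R) -> d i / 2 <= g t.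
Proof.
move=> ti.
have t0 : 0 <= t.
  by rewrite -(pmulr_lge0 _ (ln_nat2_gt0 i)) (le_trans _ ti)// ltW// (ln_nat2_gt0 0%N).
have wge k : (i <= k)%N -> c k / 2 <= w t k.
  move=> ik; rewrite ler_wpM2l// lerBrDr -lerBrDl.
  rewrite (_ : 1 - 2^-1 = 2^-1); last by field.
  rewrite -[leRHS]lnK ?posrE ?invr_gt0// lnV ?posrE// ler_expR lerN2.
  rewrite (le_trans ti)// ler_wpM2l// ler_ln ?posrE ?ltr0n// ler_nat !ltnS//.
have S m : (d i - d (i + m)%N) / 2 <= series (w t) (i + m)%N.
  elim: m => [|m IH]; first by rewrite addn0 subrr mul0r sumr_ge0// => k _; exact: w_ge0.
  rewrite addnS /series /= big_nat_recr//=.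
  have := wge (i + m)%N (leq_addr _ _); rewrite /c.
  move: IH; rewrite /series /=; lra.
have [_ _ d0] := gd.
(* Adding d_n / 2 makes the lower bound S independent of n. *)
have lim_sum : (fun n => series (w t) n + d n / 2) @ \oo --> g t.
  rewrite -[g t]addr0 -[X in g t + X](mul0r (2^-1 : R)).
  by apply: cvgD; [exact: cvg_w|apply: cvgM => //; exact: cvg_cst].
apply: (cvgr_to_ge lim_sum); exists i => // n /= /subnKC <-.
by have := S (n - i)%N; lra.
Qed.

(* Terms of index k < K are estimated by 1 - e^(-u) <= u, the others by c_k;
   as K is arbitrary, g tends to 0 at 0. *)
Let g_le t K : 0 <= t -> g t <= d K + d 0%N * (t * ln (K.+2%:R : R)).
Proof.
move=> t0; set B := t * _; have B0 : 0 <= B by rewrite mulr_ge0// ltW// ln_nat2_gt0.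
have [dni _ _] := gd.
apply: limr_le; first exact: cvg_w.
(* The second summand is the sum of c_k over K <= k < n. *)
suff S n : series (w t) n <= (d 0%N - d n) * B + (d (minn n K) - d n).
  apply: nearW => n; apply: (le_trans (S n)).
  rewrite addrC lerD//.
    have [nK|/ltnW Kn] := leqP n K; last by rewrite gerBl ltW.
    by rewrite subrr ltW.
  by rewrite ler_wpM2r// gerBl ltW.
elim: n => [|n IH].
  by rewrite /series /= big_geq// min0n !subrr mul0r addr0.
rewrite /series /= big_nat_recr//=.
have [nK|Kn] := ltnP n K.
  have : w t n <= c n * B.
    rewrite ler_wpM2l//.
    have := expR_ge1Dx (- (t * ln (n.+2%:R : R))).
    have : t * ln (n.+2%:R : R) <= B.
      by rewrite ler_wpM2l// ler_ln ?posrE ?ltr0n// ler_nat !ltnS ltnW.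
    lra.
  move: IH; rewrite (minn_idPl (ltnW nK)) (minn_idPl nK) /series /= /c.
  lra.
have : w t n <= c n by rewrite ler_piMr// gerBl expR_ge0.
move: IH; rewrite (minn_idPr Kn) (minn_idPr (leqW Kn)) /series /=.
have : 0 <= c n * B by rewrite mulr_ge0.
rewrite /c; lra.
Qed.

(** The sum of c_k (1 - (k+2)^(-s)), c_k = d_k - d_(k+1), increases with real s,
    so its values at the nodes are again a gauge and the construction can be
    iterated. *)
Lemma bounded_dirichlet_series_ge_gauge : exists (f : Hinf R) (x : nat -> R),
  [/\ gauge x, forall i, f (node_pt i) = (x i)%:C & forall i, d i / 2 <= x i].
Proof.
exists (MkHinf (dirichlet_sum_bdd_dirichlet av cvg_v)), (g \o node).
have node_ge0 i := ltW (node_gt0 i).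
have ge i : d i / 2 <= g (node i).
  by apply: g_ge; rewrite /node divfK// gt_eqF// ln_nat2_gt0.
split => //; last by move=> i /=; rewrite dirichlet_sum_real.
split=> [i j ij|i|].
- by apply: g_nondecreasing => //; exact: node_nonincreasing.
- apply/andP; split; first by rewrite (lt_le_trans _ (ge i))// divr_gt0.
  by rewrite (le_lt_trans (g_le_d0 _))//; have [_ /(_ 0%N)/andP[]] := gd.
apply/cvgr0Pnorm_le => e e0.
have [_ _ /cvgr0Pnorm_le d0] := gd.
have e20 : 0 < e / 2 by rewrite divr_gt0.
have [K _ /(_ K (leqnn K))/= dK] := d0 _ e20.
have lK := ln_nat2_gt0 K.
have := divr_gt0 e20 lK.
have /cvgr0Pnorm_le := node_cvg0 => /[apply]; apply: filterS => i.
rewrite ger0_norm// ler_pdivlMr// => iK.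
rewrite ger0_norm; last by rewrite (le_trans _ (ge i))// divr_ge0// ltW.
have := g_le K (node_ge0 i); rewrite (ger0_norm (ltW (d_gt0 K))) in dK.
have [_ /(_ 0%N)/andP[_ d01] _] := gd.
have : d 0%N * (node i * ln (K.+2%:R : R)) <= node i * ln (K.+2%:R : R).
  by apply: ler_piMl; rewrite ?(ltW d01)// mulr_ge0// ltW.
rewrite /=; lra.
Qed.

End dirichlet_series_of_a_gauge.
Lemma slower_bounded_dirichlet_series x : gauge x ->
  exists (f : Hinf R) (y : nat -> R),
  [/\ gauge y, forall i, f (node_pt i) = (y i)%:C &
    forall m, \forall i \near \oo, x i <= y i ^+ m].
Proof.
move=> gx; have gs := slower_gauge gx.
have [f [y [gy fy sy]]] := bounded_dirichlet_series_ge_gauge gs.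
exists f, y; split=> // m; apply: filterS (gauge_le_slowerX m gx) => i.
move/le_trans; apply; have [_ /(_ i)/andP[s0 _] _] := gs.
by rewrite lerXn2r ?nnegrE ?(le_trans _ (sy i)) ?divr_ge0 ?(ltW s0).
Qed.

End gauges.

(** * Prime ideals of functions of fast decay *)

Section ideals_of_fast_decay.
Variables (R : realType) (p : nat -> halfplane R).
Variables (U : set_system nat) (UU : UltraFilter U).
Variable x : nat -> R.
Hypothesis x_gt0 : forall i, 0 < x i.
Hypothesis x_cvg0 : x @ U --> (0 : R).

Definition fast_decay : {pred Hinf R} := fun f =>
  `[< forall m, \forall i \near U, `|f (p i)| <= (x i ^+ m)%:C >].

Let near_bound (B : R) m :
  \forall i \near U, B * x i ^+ m.+1 <= x i ^+ m.
Proof.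
have B1 : 0 < (`|B| + 1)^-1 by rewrite invr_gt0 ltr_wpDl.
move/cvgr0Pnorm_le : x_cvg0 => /(_ _ B1); apply: filterS => i.
rewrite ger0_norm ?(ltW (x_gt0 i))// -[leRHS]div1r ler_pdivlMr ?ltr_wpDl// => h.
rewrite exprS mulrA ler_piMl ?exprn_ge0 ?(ltW (x_gt0 i))//.
have : B * x i <= `|B| * x i by rewrite ler_wpM2r ?ler_norm ?(ltW (x_gt0 i)).
have := x_gt0 i; lra.
Qed.

(** If |f|, |g| <= x^(m+1) and |a| <= M at p_i, then |a f + g| <= (M+1) x^(m+1),
    and (M+1) x <= 1 eventually. *)
Lemma fast_decay_idealr : idealr_closed fast_decay.
Proof.
split.
- apply/asboolP => m; apply: nearW => i; rewrite normr0 ler0c.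
  by rewrite exprn_ge0// ltW.
- apply/asboolP => /(_ 1%N) h1.
  have [i [h2 h3]] := filter_ex (filterI h1 (near_bound 2 0)).
  move: h2; rewrite normr1 (_ : 1 = (1 : R)%:C)// lecR.
  by move: h3 => /=; rewrite expr0 expr1; lra.
move=> a f g /asboolP hf /asboolP hg; apply/asboolP => m.
have [_ [M aM] _] : [/\ holomorphic a, bounded_hp a & has_dirichlet_series a].
  exact/asboolP/(Hinf_prop a).
have M0 : 0 <= M by rewrite (le_trans _ (aM (p 0%N))).
have ME : M = (complex.Re M)%:C by rewrite RRe_real ?ger0_real.
near=> i.
have -> : (a * f + g) (p i) = a (p i) * f (p i) + g (p i) by [].
rewrite (le_trans (ler_normD _ _))// normrM.
apply: (@le_trans _ _ (M * (x i ^+ m.+1)%:C + (x i ^+ m.+1)%:C)).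
  rewrite lerD//; last by near: i; exact: hg.
  by rewrite ler_pM//; near: i; exact: hf.
rewrite ME -rmorphM -rmorphD lecR -[X in _ + X]mul1r -mulrDl.
by near: i; exact: near_bound.
Unshelve. all: by end_near. Qed.

(** This is where U has to be an ultrafilter: failure of |f(p_i)| <= x_i^m
    U-almost everywhere gives the reverse inequality U-almost everywhere, so
    that the lower bounds for f and for g hold at a common index. *)
Lemma fast_decay_prime : prime_idealr_closed fast_decay.
Proof.
have slow (f : Hinf R) : f \notin fast_decay ->
    exists m, \forall i \near U, (x i ^+ m)%:C < `|f (p i)|.
  move=> /asboolPn/existsNP[m nfm]; exists m.
  have [//|] := in_ultra_setVsetC [set i | `|f (p i)| <= (x i ^+ m)%:C] UU.
  apply: filterS => i /= /negP.
  rewrite -real_ltNge ?normr_real// ger0_real// ler0c exprn_ge0// ltW//.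
move=> f g fg; apply/orP; case: (boolP (f \in _)) => [|/slow[m hf]]; first by left.
case: (boolP (g \in _)) => [|/slow[k hg]]; first by right.
exfalso; move/asboolP : fg => /(_ (m + k)%N) fg.
have [i [fgi [fi gi]]] := filter_ex (filterI fg (filterI hf hg)).
move: fgi; have -> : (f * g) (p i) = f (p i) * g (p i) by [].
apply/negP; rewrite -real_ltNge ?normr_real//; last first.
  by rewrite ger0_real// ler0c exprn_ge0// ltW.
by rewrite normrM exprD rmorphM ltr_pM// ler0c exprn_ge0// ltW.
Qed.

Definition fast_decay_prime_ideal : prime_idealr (Hinf R) :=
  HB.pack (fast_decay : Hinf R -> bool)
    (isIdealr.Build _ _ fast_decay_idealr)
    (isPrimeIdealrClosed.Build _ _ fast_decay_prime).

End ideals_of_fast_decay.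

(** * Infinite chains of prime ideals *)

Section infinite_sequence_of_speeds.
Variable R : realType.

Lemma harmonic_gauge : gauge (fun i => harmonic i.+1 : R).
Proof.
split=> [i j ij|i|].
- by rewrite /harmonic lef_pV2 ?posrE ?ltr0n// ler_nat !ltnS.
- by rewrite /harmonic invr_gt0 ltr0n invf_lt1 ?ltr0n// ltr1n.
by rewrite (@cvg_shiftS R^o (@harmonic R)); exact: cvg_harmonic.
Qed.

Lemma gauge_sequence_in_Hinf :
  exists (f : nat -> Hinf R) (x : nat -> nat -> R),
  [/\ forall k, gauge (x k), forall k i, f k (node_pt R i) = (x k i)%:C &
    forall k m, \forall i \near \oo, x k i <= x k.+1 i ^+ m].
Proof.
have /choice[next nextP] (x : {x : nat -> R | gauge x}) :
    exists fy : Hinf R * {y : nat -> R | gauge y},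
      (forall i, fy.1 (node_pt R i) = (sval fy.2 i)%:C) /\
      (forall m, \forall i \near \oo, sval x i <= sval fy.2 i ^+ m).
  have [f [y [gy fy xy]]] := slower_bounded_dirichlet_series (svalP x).
  by exists (f, exist _ y gy).
pose X k := iter k (fun x => (next x).2) (exist _ _ harmonic_gauge).
exists (fun k => (next (X k)).1), (fun k => sval (X k.+1)).
split=> [k|k i|k m].
- exact: svalP.
- by have [] := nextP (X k).
- by have [] := nextP (X k.+1).
Qed.

End infinite_sequence_of_speeds.

Theorem corollary1p10 (R : realType) : krull_dim R (Hinf R) = +oo%E.
Proof.
have [f [x [gx fx xS]]] := gauge_sequence_in_Hinf R.
have [U [UU oU]] := ultraFilterLemma (eventually_filter).
have x_gt0 k i : 0 < x k i by have [_ /(_ i)/andP[]] := gx k.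
have x_cvg0 k : x k @ U --> (0 : R).
  have [_ _ h] := gx k; exact: cvg_trans (cvg_app _ oU) h.
(* Shrinking x shrinks the ideal, so P is increasing; f k lies in P k.+1 but
   not in P k. *)
pose P k := fast_decay_prime_ideal (@node_pt R) UU (x_gt0 k) (x_cvg0 k).
have PP k g : (g \in P k) <->
    forall m, \forall i \near U, `|g (node_pt R i)| <= (x k i ^+ m)%:C.
  by split=> /asboolP.
have PS k : [set` P k] `<=` [set` P k.+1].
  move=> g /= /PP h; apply/PP => m; near=> i.
  apply: (@le_trans _ _ (x k i ^+ m)%:C); first by near: i; exact: h.
  rewrite lecR lerXn2r ?nnegrE ?(ltW (x_gt0 _ _))//.
  rewrite -[leRHS]expr1; near: i; exact/oU/xS.
have Psub j k : (j <= k)%N -> [set` P j] `<=` [set` P k].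
  elim: k => [|k IH]; first by rewrite leqn0 => /eqP ->.
  rewrite leq_eqVlt => /predU1P[->//|/IH/subset_trans]; apply; exact: PS.
have fPS k : [set` P k.+1] (f k).
  apply/PP => m; apply/oU; apply: filterS (xS k m) => i xi.
  by rewrite fx ger0_norm ?ler0c ?lecR// ltW.
have fP k : ~ [set` P k] (f k).
  move=> /PP/(_ 2) h.
  have [_ x01 _] := gx k; have [j] := filter_ex h.
  rewrite fx ger0_norm ?ler0c ?(ltW (x_gt0 _ _))// lecR leNgt => /negP; apply.
  by rewrite expr2 gtr_pMl//; case/andP: (x01 j).
apply: eq_infty => r; pose n := Num.bound `|r|.
apply: (@le_trans _ _ n%:R%:E).
  rewrite lee_fin (le_trans (ler_norm r))// ltW//; exact: archi_boundP.
apply: ereal_sup_ubound; exists n => //; exists (fun i => P i) => i j ij.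
split; first exact/Psub/ltnW.
by move=> h; apply: (fP i); apply: h; apply: (Psub _ _ ij); exact: fPS.
Unshelve. all: by end_near. Qed.
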